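(* Let $(n_k)_{k\in\mathbb{N}}$ and $(m_k)_{k\in\mathbb{N}}$ be strictly increasing sequences of positive integers such that $$\gcd(n_k,n_{k+l})<m_l\quad\text{for all positive integers } k \text{ and } l.$$ Then $(n_k)_{k\in\mathbb{N}}$ has the $P_1$ property, i.e. there exist infinitely many prime numbers $p$ such that $p$ divides $n_k$ for at least one $k\in\mathbb{N}$.
   Context: Here $\mathbb{N}=\{1,2,3,\dots\}$. A sequence $(n_k)_{k\in\mathbb{N}}$ of positive integers is said to have the $P_1$ property (written $(n_k)_{k\in\mathbb{N}}\in P_1$) if there exist infinitely many prime numbers dividing at least one term of the sequence. *)

(* Defs.v *)
From mathcomp Require Import all_boot.
From mathcomp Require Import boolp classical_sets cardinality.
Set Implicit Arguments.
Unset Strict Implicit.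
Unset Printing Implicit Defensive.
Local Open Scope classical_set_scope.
Local Open Scope nat_scope.

(* Sequences (u_k) with k in {1, 2, 3, ...} are functions nat -> nat whose
   value at 0 is irrelevant: every condition below is restricted to indices
   k > 0. *)

Definition positive_seq (u : nat -> nat) : Prop :=
  forall k : nat, 0 < k -> 0 < u k.

Definition strictly_increasing_seq (u : nat -> nat) : Prop :=
  forall i j : nat, 0 < i -> i < j -> u i < u j.

Definition P1_property (u : nat -> nat) : Prop :=
  infinite_set [set p : nat | prime p /\ exists k : nat, 0 < k /\ p %| u k].

(* Main.v *)
Require Import Defs.
From mathcomp Require Import all_boot.
From mathcomp Require Import classical_sets cardinality.

(** Suppose that all prime factors of the terms lie in a finite list of r
    primes.  A term larger than B ^ r is a product of at most r prime powers,
    so one of these powers exceeds B ([exists_large_partn]).  Far enough in the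
    sequence this happens for r + 1 consecutive terms, and by the pigeonhole
    principle two of them, at distance l with 0 < l <= r, have a large power of
    the same prime; the smaller of the two powers divides both terms, so their
    gcd exceeds B ([partn_gcd_gt]).  Since m is increasing, the hypothesis
    bounds all gcds at distance at most r by a constant; taking this constant
    as B gives a contradiction. *)

(** The p-parts for p in [primes N] multiply to N and there are at most
    [size s] of them, so they cannot all be at most B. *)
Lemma exists_large_partn (s : seq nat) (B N : nat) :
  0 < B -> {subset primes N <= s} -> B ^ size s < N ->
  exists2 p, p \in s & B < N`_p.
Proof.
move=> B_gt0 sub_s lt_N.
have N_gt0 : 0 < N by apply: leq_ltn_trans lt_N.
have [/hasP[p sp lt_p]|/hasPn small] := boolP (has (fun p : nat => B < N`_p) s).
  by exists p.
have le_N : N <= B ^ size (primes N).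
  rewrite {1}(prod_prime_decomp N_gt0) prime_decompE big_map /=.
  rewrite -[size _]count_predT -[B ^ _]iter_muln_1 -big_const_seq.
  rewrite big_seq [leqRHS]big_seq; apply: leq_prod => p /sub_s sp.
  by rewrite -p_part leqNgt small.
have le_size : B ^ size (primes N) <= B ^ size s.
  by apply: leq_pexp2l => //; apply: uniq_leq_size; rewrite ?primes_uniq.
by move: (leq_trans le_N le_size); rewrite leqNgt lt_N.
Qed.

(** The p-part of a gcd is the smaller of the two p-parts. *)
Lemma partn_gcd_gt (p B a b : nat) :
  0 < a -> 0 < b -> B < a`_p -> B < b`_p -> B < gcdn a b.
Proof.
move=> a_gt0 b_gt0 lt_a lt_b.
have gcd_gt0 : 0 < gcdn a b by rewrite gcdn_gt0 a_gt0.
apply: leq_trans (dvdn_leq gcd_gt0 (dvdn_part p _)).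
rewrite p_part logn_gcd // /minn.
by case: ifP => _; rewrite -p_part.
Qed.

Lemma strictly_increasing_seq_ge (u : nat -> nat) (k : nat) :
  strictly_increasing_seq u -> 0 < k -> k <= u k.+1.
Proof.
move=> u_incr; elim: k => // -[_ _|k IHk _].
  by apply: leq_ltn_trans (u_incr 1 2 _ _).
by apply: leq_ltn_trans (IHk _) (u_incr _ _ _ _).
Qed.

Theorem theorem0p2 (n m : nat -> nat)
  (n_pos : positive_seq n) (n_incr : strictly_increasing_seq n)
  (m_pos : positive_seq m) (m_incr : strictly_increasing_seq m)
  (gcd_lt : forall k l : nat, 0 < k -> 0 < l -> gcdn (n k) (n (k + l)) < m l) :
  P1_property n.
Proof.
rewrite /P1_property => /finite_seqP[s s_primes].
have primes_sub k : 0 < k -> {subset primes (n k) <= s}.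
  move=> k_gt0 p; rewrite mem_primes => /and3P[p_prime _ p_dvd].
  have : [set` s]%classic p by rewrite -s_primes; split=> //; exists k.
  by [].
(* The index is size s + 1 rather than size s because m 0 is arbitrary. *)
pose B := m (size s).+1.
have B_gt0 : 0 < B by apply: m_pos.
(* Since n j.+1 >= j, every term from this index on exceeds B ^ size s. *)
pose k0 := (B ^ size s).+2.
have has_large j : has (fun p : nat => B < (n (k0 + j))`_p) s.
  have [||p sp lt_p] := exists_large_partn s B (n (k0 + j)) B_gt0.
  - exact: primes_sub.
  - apply: leq_trans (_ : k0.-1 + j <= _); first by rewrite leq_addr.
    exact: strictly_increasing_seq_ge.
  by apply/hasP; exists p.
(* The positions in s of the chosen primes are the pigeonholes. *)
pose f j := find (fun p : nat => B < (n (k0 + j))`_p) s.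
have f_lt j : f j < size s by rewrite -has_find.
have : ~~ uniq (mkseq f (size s).+1).
  apply/negP => f_uniq.
  have sub_iota : {subset mkseq f (size s).+1 <= iota 0 (size s)}.
    by move=> _ /mapP[j _ ->]; rewrite mem_iota f_lt.
  by have := uniq_leq_size f_uniq sub_iota; rewrite size_mkseq size_iota ltnn.
case/(uniqPn 0) => i [j [lt_ij]]; rewrite size_mkseq => lt_j.
rewrite !nth_mkseq ?(ltn_trans lt_ij) // => eq_f.
have := nth_find 0 (has_large j); rewrite -/(f j) -eq_f.
have := nth_find 0 (has_large i); rewrite -/(f i).
move=> large_i large_j.
have l_gt0 : 0 < j - i by rewrite subn_gt0.
have lt_l : j - i < (size s).+1 by apply: leq_ltn_trans (leq_subr _ _) lt_j.
have := gcd_lt (k0 + i) (j - i) isT l_gt0.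
rewrite -addnA (subnKC (ltnW lt_ij)) => gcd_small.
have gcd_large : B < gcdn (n (k0 + i)) (n (k0 + j)).
  by apply: partn_gcd_gt large_i large_j; apply: n_pos.
have := ltn_trans gcd_large (ltn_trans gcd_small (m_incr _ _ l_gt0 lt_l)).
by rewrite ltnn.
Qed.
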